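(* Let $(X,T)$ be a topological dynamical system, $\mu\in M(X,T)$ and $f\in L^2(\mu)$. Then $f$ is rigid if and only if there exists an IP-set $F\subset\mathbb{N}$ such that $f$ is $\mu$-$F$-equicontinuous.
   Context: A topological dynamical system $(X,T)$ is a non-empty compact metric space $X$ with metric $d$ together with a homeomorphism $T:X\to X$. $M(X,T)$ is the set of $T$-invariant regular Borel probability measures on $X$. $\mathbb{N}$ denotes the non-negative integers. A subsequence $A=\{a_i:i\in\mathbb{N}\}$ of $\mathbb{N}$ is an infinite set of natural numbers listed in strictly increasing order. $f\in L^2(\mu)$ is rigid if there is a subsequence $\{t_k\}$ of $\mathbb{N}$ (possibly depending on $f$) such that $f\circ T^{t_k}\to f$ in $L^2(\mu)$. For a sequence $\{b_i:i\in\mathbb{N}\}$ of positive integers let $FS\{b_i\}=\{b_{i_1}+\cdots+b_{i_k}: i_1<\cdots<i_k,\ k\geq 1\}$. A set $F\subset\mathbb{N}$ is an IP-set if $F=FS\{b_i\}$ for some such $\{b_i\}$; an IP-set is regarded as a subsequence of $\mathbb{N}$ by listing its elements in increasing order. For a subsequence $A=\{a_i\}$ of $\mathbb{N}$, a subset $K\subset X$ is $f$-$A$-equicontinuous if for every $\epsilon>0$ there is $\delta>0$ such that for all $x,y\in K$ with $d(x,y)<\delta$ one has $|f(T^{a_n}x)-f(T^{a_n}y)|<\epsilon$ for all $n\in\mathbb{N}$. $f$ is $\mu$-$A$-equicontinuous if for every $\tau>0$ there is a compact $f$-$A$-equicontinuous set $K\subset X$ with $\mu(K)>1-\tau$. (Here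 $f$ is evaluated pointwise through a representative.) *)

(* Defs.v *)
From HB Require Import structures.
From mathcomp Require Import all_boot all_order all_algebra.
From mathcomp Require Import all_classical all_reals all_analysis.
From mathcomp Require Import complex.

Set Implicit Arguments.
Unset Strict Implicit.
Unset Printing Implicit Defensive.

Import Order.TTheory GRing.Theory Num.Theory.
Import ComplexField.Normc.

Local Open Scope classical_set_scope.
Local Open Scope ring_scope.

(* Non-empty metric spaces: [g_sigma_algebraType] asks for a pointed type. *)
#[short(type="pointedMetricType")]
HB.structure Definition PointedMetric (R : numDomainType) :=
  {X of Metric R X & Pointed X}.

Notation borel X := (g_sigma_algebraType (@open X)).

Definition homeomorphism (X Y : topologicalType) (T : X -> Y) : Prop :=
  continuous T /\
  exists S : Y -> X, [/\ continuous S, cancel T S & cancel S T].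

Section TopologicalDynamics.
Context (R : realType) (X : pointedMetricType R).
Implicit Types (mu : probability (borel X) R) (T : X -> X) (f g : X -> R[i]).

Definition regular_measure mu : Prop :=
  forall A : set (borel X), measurable A ->
    mu A = ereal_sup [set mu K | K in [set K : set X | compact K /\ K `<=` A]]
    /\
    mu A = ereal_inf [set mu U | U in [set U : set X | open U /\ A `<=` U]].

Definition invariant_measure mu T : Prop :=
  forall A : set (borel X), measurable A -> mu (T @^-1` A) = mu A.

(* L^2 functions are complex-valued and given by Borel representatives.
   [normc] is the modulus with values in [R], whereas [`|z|] lies in [R[i]]. *)
Definition L2 mu f : Prop :=
  [/\ measurable_fun [set: borel X] (@complex.Re R \o f),
      measurable_fun [set: borel X] (@complex.Im R \o f) &
      ('N[mu]_2%:E[EFin \o @normc R \o f] < +oo)%E].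

Definition L2dist mu f g : \bar R :=
  ('N[mu]_2%:E[EFin \o @normc R \o (f \- g)%R])%E.

Definition rigid mu T f : Prop :=
  exists t : nat -> nat, increasing_seq t /\
    L2dist mu (fun x => f (iter (t k) T x)) f @[k --> \oo] --> 0%E.

Definition equicontinuous_along T f (a : nat -> nat) (K : set X) : Prop :=
  forall eps : R, 0 < eps -> exists delta : R, 0 < delta /\
    forall x y : X, K x -> K y -> mdist x y < delta ->
      forall n : nat, normc (f (iter (a n) T x) - f (iter (a n) T y)) < eps.

Definition mu_equicontinuous_along mu T f (a : nat -> nat) : Prop :=
  forall tau : R, 0 < tau -> exists K : set X,
    [/\ compact K, equicontinuous_along T f a K & ((1 - tau)%:E < mu K)%E].

End TopologicalDynamics.

Definition FS (b : nat -> nat) : set nat :=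
  [set n | exists s : seq nat,
    [/\ s <> [::], sorted ltn s & n = (\sum_(i <- s) b i)%N]].

Definition IP_set (F : set nat) : Prop :=
  exists b : nat -> nat, (forall i, (0 < b i)%N) /\ F = FS b.

Definition increasing_listing (F : set nat) (a : nat -> nat) : Prop :=
  increasing_seq a /\ range a = F.

(* Main.v *)
Require Import Defs.
From HB Require Import structures.
From mathcomp Require Import finmap.
From mathcomp Require Import all_boot all_order all_algebra.
From mathcomp Require Import all_classical all_reals all_analysis.
From mathcomp Require Import measurable_realfun complex lra ring zify.

(** Write u_n for f o T^n.

    From rigidity to equicontinuity. Rigidity provides times b_0, b_1, ...
    with || u_{b_i} - f ||_2 <= 4^-(i+1); let F = FS(b). There are only 2^i sums
    m of subsets of {b_0, ..., b_(i-1)}, so by the Markov inequality and the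
    invariance of mu, the set where u_{b_i + m} and u_m differ by at least
    2^-(i+1) for one of these m has measure at most 2^-(i+1)
    ([jump_set_small]). Outside the union of these sets over i >= N, dropping
    from n in F its generators of index >= M, for any M >= N, changes u_n by at
    most 2^-M ([telescope_off_jump_sets]): uniformly, the family (u_n) over
    n in F is as close as desired to finitely many functions u_m. A Lusin
    theorem for countably many functions ([regular_lusin]) makes all the u_m
    uniformly continuous on one compact set of nearly full measure that avoids
    this union ([fast_times_equicontinuous]).

    From equicontinuity to rigidity. Let a list F in increasing order. On a
    compact K of nearly full measure along which f is equicontinuous, u_{a_n} is
    determined up to a small error by its values at the points of a finite net,
    and these take finitely many values up to rounding, once all values of large
    modulus are identified. By the pigeonhole principle two distant indices
    i < j receive the same rounded values, so that u_{a_i} and u_{a_j} are close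
    on K wherever they are not both large. The contributions
    of large values and of the complement of K to the integral are small because
    all u_n have the same distribution ([integral_truncation_bound]). Thus
    || u_{a_i} - u_{a_j} ||_2 is small, and by invariance it equals
    || u_{a_j - a_i} - f ||_2 ([equicontinuous_almost_return]). *)

Set Implicit Arguments.
Unset Strict Implicit.
Unset Printing Implicit Defensive.
Import Order.TTheory GRing.Theory Num.Theory.
Import numFieldNormedType.Exports.
Import ComplexField.Normc.

Local Open Scope classical_set_scope.
Local Open Scope ring_scope.

(** * Modulus of complex numbers *)

Section ModulusOfComplex.
Context {R : realType}.
Implicit Types z w : R[i].

Lemma sqr_normcE z : normc z ^+ 2 = complex.Re z ^+ 2 + complex.Im z ^+ 2.
Proof. by case: z => a b; rewrite /normc sqr_sqrtr// addr_ge0 ?sqr_ge0. Qed.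

Lemma normc_ge0 z : 0 <= normc z.
Proof. by case: z => a b; exact: sqrtr_ge0. Qed.

Lemma normc_le_ReIm z : normc z <= `|complex.Re z| + `|complex.Im z|.
Proof.
rewrite -ler_sqr ?nnegrE ?normc_ge0 ?addr_ge0// sqr_normcE.
have := normr_ge0 (complex.Re z); have := normr_ge0 (complex.Im z).
rewrite -(real_normK (num_real (complex.Re z))).
by rewrite -(real_normK (num_real (complex.Im z))); nra.
Qed.

Lemma Re_le_normc z : `|complex.Re z| <= normc z.
Proof.
rewrite -ler_sqr ?nnegrE ?normc_ge0// sqr_normcE real_normK ?num_real//.
by rewrite lerDl sqr_ge0.
Qed.

Lemma Im_le_normc z : `|complex.Im z| <= normc z.
Proof.
rewrite -ler_sqr ?nnegrE ?normc_ge0// sqr_normcE real_normK ?num_real//.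
by rewrite lerDr sqr_ge0.
Qed.

Lemma normcB z w : normc (z - w) = normc (w - z).
Proof. by rewrite -normcN opprB. Qed.

Lemma normcB_le z w u : normc (z - u) <= normc (z - w) + normc (w - u).
Proof. by rewrite (le_trans _ (le_normcD _ _))// addrA subrK. Qed.

Lemma sqr_normcB_le z w :
  normc (z - w) ^+ 2 <= 2 * normc z ^+ 2 + 2 * normc w ^+ 2.
Proof.
have zw := le_normcD z (- w); rewrite normcN in zw.
have : normc (z - w) ^+ 2 <= (normc z + normc w) ^+ 2.
  by rewrite ler_sqr ?nnegrE ?addr_ge0 ?normc_ge0.
by have := sqr_ge0 (normc z - normc w); nra.
Qed.

End ModulusOfComplex.

(** * Borel dynamics and squared L2 norms *)

Lemma cvg0_eventually_lt (R : realType) (u : nat -> \bar R) (e : R) :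
  u @ \oo --> 0%E -> 0 < e -> exists N, forall n, (N <= n)%N -> (u n < e%:E)%E.
Proof.
move=> u0 e0; have [|N _ NP] := u0 (fun y => (y < e%:E)%E).
  by apply: open_ereal_lt'; rewrite lte_fin.
by exists N => n Nn; exact: NP.
Qed.

Section BorelDynamics.
Context (R : realType) (X : pointedMetricType R).
Implicit Types (T : X -> X) (f g : X -> R[i]) (mu : probability (borel X) R).

Lemma open_borel (U : set X) : open U -> measurable (U : set (borel X)).
Proof. exact: sub_sigma_algebra. Qed.

Lemma compact_borel (K : set X) : compact K -> measurable (K : set (borel X)).
Proof.
move=> /(compact_closed (@metric_hausdorff R X)) cK.
rewrite -(setCK K); apply: measurableC.
by apply: open_borel; exact: closed_openC.
Qed.

Lemma continuous_iter T n : continuous T -> continuous (iter n T).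
Proof.
move=> cT; elim: n => [|n IHn]; first by move=> x A.
move=> x.
by apply: (@continuous_comp X X X (iter n T) T x); [exact: IHn|exact: cT].
Qed.

Lemma measurable_iter T n : continuous T ->
  measurable_fun [set: borel X] (iter n T : borel X -> borel X).
Proof.
move=> cT; apply: (@measurability _ _ (borel X) (borel X) _ _ (@open X)) => //.
move=> _ [U oU <-]; rewrite setTI.
by apply: open_borel; have /continuousP := @continuous_iter T n cT; apply.
Qed.

Definition borel_complex f :=
  measurable_fun [set: borel X] (@complex.Re R \o f) /\
  measurable_fun [set: borel X] (@complex.Im R \o f).

Lemma borel_complex_iter f T n : continuous T -> borel_complex f ->
  borel_complex (f \o iter n T).
Proof.
move=> cT [mRe mIm]; have mT := @measurable_iter T n cT.
by split; [exact: (measurableT_comp mRe mT)|exact: (measurableT_comp mIm mT)].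
Qed.

Lemma borel_complexB f g : borel_complex f -> borel_complex g ->
  borel_complex (f \- g).
Proof.
move=> [fR fI] [gR gI]; split.
- rewrite (_ : _ \o _ = (@complex.Re R \o f) \- (@complex.Re R \o g)).
    exact: measurable_funB.
  by apply/funext => x /=; case: (f x) (g x) => [a b] [c d].
- rewrite (_ : _ \o _ = (@complex.Im R \o f) \- (@complex.Im R \o g)).
    exact: measurable_funB.
  by apply/funext => x /=; case: (f x) (g x) => [a b] [c d].
Qed.

Lemma measurable_sqr_normc f : borel_complex f ->
  measurable_fun [set: borel X] (fun x => normc (f x) ^+ 2).
Proof.
move=> [mRe mIm]; under eq_fun do rewrite sqr_normcE.
by apply: measurable_funD; apply: measurable_funX.
Qed.

(** Invariance says that T pushes mu forward to itself, so composing with an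
    iterate of T does not change the integral. *)
Lemma invariant_integral mu T n (phi : borel X -> R) :
  continuous T -> invariant_measure mu T ->
  measurable_fun setT phi -> (forall x, 0 <= phi x) ->
  (\int[mu]_x (phi (iter n T x))%:E = \int[mu]_x (phi x)%:E)%E.
Proof.
move=> cT muT mphi phi0; elim: n => [//|n <-].
have mT : measurable_fun setT (T : borel X -> borel X) := measurable_iter 1 cT.
have mf : measurable_fun setT (fun x : borel X => (phi (iter n T x))%:E).
  apply/measurable_EFinP; exact: (measurableT_comp mphi (measurable_iter n cT)).
pose mT_mixin := isMeasurableFun.Build _ _ _ _ _ mT.
pose Tm : {mfun borel X >-> borel X} :=
  HB.pack (T : borel X -> borel X) mT_mixin.
transitivity (\int[pushforward mu Tm]_x (phi (iter n T x))%:E)%E.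
  rewrite (ge0_integral_pushforward mT)//; last by move=> x _; rewrite lee_fin.
  by apply: eq_integral => x _; rewrite /= -iterSr.
by apply: eq_measure_integral => A mA _; exact: muT.
Qed.

(** The squared L2 norm; working with it avoids roots and reduces estimates to
    pointwise ones. *)
Definition energy mu g : \bar R := (\int[mu]_x (normc (g x) ^+ 2)%:E)%E.

Lemma L2dist_sqr mu f g : (L2dist mu f g `^ 2 = energy mu (f \- g)%R)%E.
Proof.
rewrite /L2dist poweR_Lnorm ?pnatr_eq0//; apply: eq_integral => x _ /=.
by rewrite ger0_norm ?normc_ge0// powR_mulrn ?normc_ge0.
Qed.

Lemma L2dist_ge0 mu f g : (0 <= L2dist mu f g)%E.
Proof. exact: Lnorm_ge0. Qed.

Lemma L2dist_le mu f g e : 0 <= e ->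
  ((L2dist mu f g <= e%:E) = (energy mu (f \- g)%R <= (e ^+ 2)%:E))%E.
Proof.
move=> e0; rewrite -L2dist_sqr; have := L2dist_ge0 mu f g.
case: (L2dist mu f g) => [l||//]; last by rewrite poweRyr ?pnatr_eq0// !leye_eq.
by rewrite poweR_EFin !lee_fin => l0; rewrite powR_mulrn// ler_sqr ?nnegrE.
Qed.

Lemma L2_energy mu f : L2 mu f -> (energy mu f < +oo)%E.
Proof.
move=> [_ _ f2]; rewrite (_ : f = f \- (fun=> 0)); last first.
  by apply/funext => x /=; rewrite subr0.
rewrite -L2dist_sqr; apply: poweR_lty.
by rewrite /L2dist (_ : f \- _ = f)//; apply/funext => x /=; rewrite subr0.
Qed.

End BorelDynamics.

(** * Lusin's theorem for countably many functions *)

Section Lusin.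
Context (R : realType) (X : pointedMetricType R) (mu : probability (borel X) R).
Implicit Types (K D : set X) (g : X -> R).

Definition uniformly_continuous_on K g := forall e : R, 0 < e ->
  exists2 d : R, 0 < d &
    forall x y, K x -> K y -> mdist x y < d -> `|g x - g y| < e.

Lemma nbhs_mdist (x : X) (U : set X) : nbhs x U ->
  exists2 d : R, 0 < d & forall y, mdist x y < d -> U y.
Proof.
move=> /nbhs_ballP[d /= d0 xdU]; exists d => // y xy.
by apply: xdU; rewrite ballEmdist.
Qed.

Lemma mdist_nbhs (x : X) (d : R) : 0 < d -> nbhs x [set y | mdist x y < d].
Proof. by rewrite -ballEmdist; exact: nbhsx_ballx. Qed.

(** If d works at x for e / 2, then every r < d / 2 works for e at all the
    points of K within d / 2 of x; compactness makes this choice of r uniform. *)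
Lemma compact_uniformly_continuous_on K g : compact K ->
  (forall x (e : R), K x -> 0 < e -> exists2 d : R, 0 < d &
     forall y, K y -> mdist x y < d -> `|g x - g y| < e) ->
  uniformly_continuous_on K g.
Proof.
move=> /compact_near_coveringP/near_covering_withinP cK cg e e0.
pose P (d : R) x := forall y, K y -> mdist x y < d -> `|g x - g y| < e.
have : \forall d \near 0^'+, K `<=` P d.
  have e2 : 0 < e / 2 by rewrite divr_gt0.
  apply: cK => x Kx; have [d d0 xd] := cg x (e / 2) Kx e2.
  exists ([set y | mdist x y < d / 2], [set r : R | r < d / 2]).
    split; first by apply: mdist_nbhs; rewrite divr_gt0.
    by apply: nbhs_right_lt; rewrite divr_gt0.
  move=> [x' r] /= [xx' rd] Kx' y Ky x'y.
  have xx'd : mdist x x' < d.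
    by rewrite (lt_trans xx')// gtr_pMr// invf_lt1 ?ltr1n.
  have xyd : mdist x y < d.
    rewrite (le_lt_trans (metric_triangle _ x' _))// (splitr d) ltrD//.
    exact: lt_trans rd.
  rewrite (_ : g x' - g y = (g x - g y) - (g x - g x')); last by ring.
  by rewrite (le_lt_trans (ler_normB _ _))// (splitr e) ltrD// xd.
move=> KP; have [d [d0 Kd]] : exists d, 0 < d /\ K `<=` P d.
  near (0 : R)^'+ => d; exists d; split; first by near: d; exact: nbhs_right_gt.
  by near: d.
by exists d => // x y Kx; exact: Kd.
Unshelve. all: by end_near. Qed.

Hypothesis mu_regular : regular_measure mu.

(** Outer regularity encloses A i in an open U i with excess below
    tau / 2^(k+2), with k the code of i. Off the union of all these excesses,
    A i and U i coincide, and inner regularity then provides K. *)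
Lemma regular_relatively_open (I : countType) (A : I -> set X) D (tau : R) :
  (forall i, measurable (A i : set (borel X))) ->
  measurable (D : set (borel X)) -> 0 < tau ->
  exists K, [/\ compact K, K `<=` D, (mu D < mu K + tau%:E)%E &
    forall i, exists U, open U /\ forall x, K x -> A i x <-> U x].
Proof.
move=> mA mD tau0.
have tau2 : 0 < tau / 2 by rewrite divr_gt0.
(* An enumeration of the family, padded with empty sets. *)
pose A' k : set (borel X) := if @unpickle I k is Some i then A i else set0.
have mA' k : measurable (A' k) by rewrite /A'; case: unpickle.
have /choice[U AU] : forall k, exists U : set X, [/\ open U, A' k `<=` U &
    (mu (U `\` A' k) <= (tau / 2 / (2 ^ k.+1)%:R)%:E)%E].
  move=> k; have e0 : 0 < tau / 2 / (2 ^ k.+1)%:R.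
    by rewrite divr_gt0// ltr0n expn_gt0.
  have [_ infE] := mu_regular (mA' k).
  have : (mu (A' k) < mu (A' k) + (tau / 2 / (2 ^ k.+1)%:R)%:E)%E.
    by rewrite lteDl ?lte_fin ?fin_num_measure.
  rewrite {1}infE => /ereal_inf_lt[_ [U [oU AU] <-] muU]; exists U; split => //.
  have mU := open_borel oU.
  have : mu (U `&` A' k) = mu (A' k) by rewrite setIidr.
  move=> muI; rewrite measureD//; last by rewrite ltey_eq fin_num_measure.
  by rewrite [X in (_ - mu X)%E]setIidr// leeBlDl ?fin_num_measure// ltW.
pose B : set (borel X) := \bigcup_k (U k `\` A' k).
have mUA k : measurable (U k `\` A' k : set (borel X)).
  by apply: measurableD => //; have [/open_borel] := AU k.
have mB : measurable B by exact: bigcupT_measurable.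
have muB : (mu B <= (tau / 2)%:E)%E.
  apply: le_trans; first exact: (measure_sigma_subadditive mu mUA mB).
  apply: le_trans (epsilon_trick0 xpredT (ltW tau2)).
  by apply: lee_nneseries => // k _; have [] := AU k.
have mG : measurable (D `\` B : set (borel X)) by exact: measurableD.
have [supE _] := mu_regular mG.
have : (mu (D `\` B) - (tau / 2)%:E < mu (D `\` B))%E.
  by rewrite lteBlDr// lteDl ?lte_fin ?fin_num_measure.
rewrite [ltRHS]supE => /ereal_sup_gt[_ [K [cK KG] <-] muK].
exists K; split => //; first by move=> x /KG[].
  have mK := compact_borel cK.
  have : (mu D <= mu (D `\` B) + mu B)%E.
    rewrite (measureDI mu mD mB) leeD2l//.
    apply: le_measure; rewrite ?inE//.
    exact: (@measurableI _ (borel X)).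
  move: muK muB; rewrite -(fineK (fin_num_measure mu _ mG)).
  rewrite -(fineK (fin_num_measure mu _ mB)) -(fineK (fin_num_measure mu _ mK)).
  rewrite -(fineK (fin_num_measure mu _ mD)) -!EFinB -!EFinD !lte_fin !lee_fin.
  by move: (fine _) (fine _) (fine _) (fine _) => *; lra.
move=> i; exists (U (pickle i)); have [oU AUi _] := AU (pickle i).
split => // x Kx; have [_ nBx] := KG x Kx.
split; first by move=> Aix; apply: AUi; rewrite /A' pickleK.
move=> Ux; have : A' (pickle i) x.
  by apply: contrapT => nA; apply: nBx; exists (pickle i).
by rewrite /A' pickleK.
Qed.

(** Making the sets where g j lies above, or below, a rational simultaneously
    relatively open in K makes every g j continuous on K, hence uniformly
    continuous by compactness. *)
Lemma regular_lusin (J : countType) (g : J -> X -> R) D (tau : R) :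
  (forall n, measurable_fun [set: borel X] (g n)) ->
  measurable (D : set (borel X)) -> 0 < tau ->
  exists K, [/\ compact K, K `<=` D, (mu D < mu K + tau%:E)%E &
    forall n, uniformly_continuous_on K (g n)].
Proof.
move=> mg mD tau0.
pose A (i : J * rat * bool) : set X :=
  if i.2 then [set x | g i.1.1 x < ratr i.1.2]
  else [set x | ratr i.1.2 < g i.1.1 x].
have mA i : measurable (A i : set (borel X)).
  rewrite /A; case: i.2.
  - by have := mg i.1.1 measurableT _ (measurable_itv `]-oo, (ratr i.1.2)[);
    rewrite setTI; congr measurable; apply/seteqP; split => x /=;
    rewrite in_itv.
  - by have := mg i.1.1 measurableT _ (measurable_itv `](ratr i.1.2), +oo[);
    rewrite setTI; congr measurable; apply/seteqP; split => x /=;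
    rewrite in_itv/= andbT.
have [K [cK KD muK KA]] := regular_relatively_open mA mD tau0.
exists K; split => // n; apply: compact_uniformly_continuous_on => // x e Kx e0.
have [p /itvP pgx] : exists q, ratr q \in `]g n x - e, (g n x)[.
  have [|q ?] := @rat_in_itvoo R (g n x - e) (g n x); last by exists q.
  by rewrite ltrBlDr ltrDl.
have [q /itvP qgx] : exists q, ratr q \in `](g n x), (g n x + e)[.
  have [|q ?] := @rat_in_itvoo R (g n x) (g n x + e); last by exists q.
  by rewrite ltrDl.
have [U [oU AU]] := KA (n, p, false); have [V [oV AV]] := KA (n, q, true).
have Ux : U x by apply/AU => //; rewrite /A/= pgx.
have Vx : V x by apply/AV => //; rewrite /A/= qgx.
have [d d0 xdUV] : exists2 d : R, 0 < d &
    forall y, mdist x y < d -> (U `&` V) y.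
  by apply: nbhs_mdist; apply: filterI; exact: open_nbhs_nbhs.
exists d => // y Ky /xdUV[/(AU y Ky) py /(AV y Ky) yq].
have : g n x - e < ratr p by rewrite pgx.
have : ratr q < g n x + e by rewrite qgx.
by move: py yq; rewrite /A/= ltr_norml; move: (ratr p) (ratr q) => *; lra.
Qed.

End Lusin.

(** * Subset sums and listings *)

Section FiniteSums.
Implicit Types (b : nat -> nat) (F : set nat).

(** A list with repetitions rather than a set of sums, so that its length is
    exactly 2^i. *)
Fixpoint subset_sums b i : seq nat :=
  if i is j.+1 then
    subset_sums b j ++ [seq (b j + m)%N | m <- subset_sums b j]
  else [:: 0%N].

Lemma size_subset_sums b i : size (subset_sums b i) = (2 ^ i)%N.
Proof.
by elim: i => //= i IHi; rewrite size_cat size_map IHi expnS mul2n addnn.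
Qed.

Lemma subset_sums_mono b i j n : (i <= j)%N ->
  n \in subset_sums b i -> n \in subset_sums b j.
Proof.
move=> /subnK <-; elim: (j - i)%N => //= k IHk /IHk.
by rewrite mem_cat => ->.
Qed.

Lemma sum_in_subset_sums b s i : sorted ltn s -> all (ltn^~ i) s ->
  (\sum_(j <- s) b j)%N \in subset_sums b i.
Proof.
rewrite (sorted_pairwise ltn_trans).
elim/last_ind: s i => [|s x IHs] i.
  by rewrite big_nil => _ _; apply: (@subset_sums_mono b 0).
rewrite pairwise_rcons all_rcons => /andP[sx ss] /andP[xi _].
rewrite -cats1 big_cat big_seq1 /=.
apply: (subset_sums_mono xi); rewrite /= mem_cat; apply/orP; right.
by rewrite addnC; apply/mapP; exists (\sum_(j <- s) b j)%N => //; exact: IHs.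
Qed.

Lemma FS_subset_sums b n : FS b n -> exists i, n \in subset_sums b i.
Proof.
move=> [s [_ s_sorted ->]]; exists (\max_(j <- s) j).+1.
apply: sum_in_subset_sums => //; apply/allP => j js.
by rewrite /= ltnS; exact: leq_bigmax_seq.
Qed.

Lemma FS_unbounded b n : (forall i, 0 < b i)%N -> exists2 m, FS b m & (n < m)%N.
Proof.
move=> b0; exists (\sum_(i <- iota 0 n.+1) b i)%N.
  by exists (iota 0 n.+1); split => //; exact: iota_ltn_sorted.
rewrite -{1}(size_iota 0 n.+1) -sum1_size; exact: leq_sum.
Qed.

(** Each next term is the least element of F above the current one. Since the
    terms grow at least like the index, no element of F is skipped. *)
Lemma unbounded_increasing_listing F : (forall n, exists2 m, F m & (n < m)%N) ->
  exists a, increasing_listing F a.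
Proof.
move=> Funb.
have exF n : exists m, `[< F m >] && (n <= m)%N.
  by have [m Fm nm] := Funb n; exists m; rewrite asboolT// ltnW.
pose next n := ex_minn (exF n).
have nextP n : [/\ F (next n), (n <= next n)%N &
    forall m, F m -> (n <= m)%N -> (next n <= m)%N].
  rewrite /next; case: ex_minnP => m /andP[/asboolP Fm nm] mP.
  split => // p Fp np.
  by apply: mP; rewrite asboolT.
pose a := fix a n := next (if n is m.+1 then (a m).+1 else 0%N).
have aS n : (a n < a n.+1)%N by have [] := nextP (a n).+1.
have a_ge n : (n <= a n)%N by elim: n => // n IHn; exact: leq_ltn_trans (aS n).
exists a; split; first by apply/increasing_seqP => n; rewrite ltEnat; exact: aS.
apply/seteqP; split => [_ [n _ <-]|m Fm].
  by case: n => [|n]; [have [] := nextP 0%N|have [] := nextP (a n).+1].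
(* The listing cannot jump over m. *)
have key n : (exists k, a k = m) \/ (a n <= m)%N.
  elim: n => [|n [|nm]]; [right|by left|].
    by have [_ _] := nextP 0%N; apply.
  have [<-|anm] := eqVneq (a n) m; first by left; exists n.
  by right; have [_ _] := nextP (a n).+1; apply => //; rewrite ltn_neqAle anm.
have [[k <-]|] := key m.+1; first by exists k.
by move=> /(leq_trans (a_ge m.+1)); rewrite ltnn.
Qed.

End FiniteSums.

(** * Rigidity implies equicontinuity along an IP-set *)

Section RigidEquicontinuous.
Context (R : realType) (X : pointedMetricType R) (mu : probability (borel X) R).
Variables (T : X -> X) (f : X -> R[i]).
Hypothesis T_continuous : continuous T.
Hypothesis mu_regular : regular_measure mu.
Hypothesis mu_invariant : invariant_measure mu T.
Hypothesis f_borel : borel_complex f.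

Lemma measure_seq_bigcup_le (F : nat -> set (borel X)) (s : seq nat) (c : R) :
  (forall n, measurable (F n)) -> (forall n, (mu (F n) <= c%:E)%E) ->
  (mu (\bigcup_(n in [set` s]) F n) <= ((size s)%:R * c)%:E)%E.
Proof.
move=> mF muF; rewrite bigcup_seq; elim: s => [|n s IHs].
  by rewrite big_nil measure0 mul0r.
rewrite big_cons (le_trans (measureU2 _ _ _))//.
  exact: bigsetU_measurable.
by rewrite /= -natr1 mulrDl mul1r addrC EFinD leeD.
Qed.

Lemma invariant_measure_iter n (A : set (borel X)) : measurable A ->
  mu (iter n T @^-1` A) = mu A.
Proof.
move=> mA; elim: n => [//|n IHn]; rewrite -[RHS]IHn.
have mB : measurable (iter n T @^-1` A : set (borel X)).
  by rewrite -[X in measurable X]setTI; exact: (measurable_iter n T_continuous).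
rewrite -(mu_invariant mB); congr (mu _).
by apply/seteqP; split => x /=; rewrite -iterSr.
Qed.

Lemma measurable_normc_ge (g : X -> R[i]) (c : R) : borel_complex g -> 0 < c ->
  measurable ([set x | (c <= normc (g x))%R] : set (borel X)).
Proof.
move=> mg c0; have mg2 := measurable_sqr_normc mg.
rewrite (_ : [set x | _] =
  [set: borel X] `&` [set x | c ^+ 2 <= normc (g x) ^+ 2]).
  exact: measurable_fun_le.
by rewrite setTI; apply/seteqP; split => x /=;
  rewrite ler_sqr ?nnegrE ?normc_ge0// ltW.
Qed.

(** Compare c^2 times the indicator of the set with the squared modulus. *)
Lemma energy_markov (g : X -> R[i]) (c : R) : borel_complex g -> 0 < c ->
  ((c ^+ 2)%:E * mu [set x | (c <= normc (g x))%R] <= energy mu g)%E.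
Proof.
move=> mg c0; have mg2 := measurable_sqr_normc mg.
have mJ := measurable_normc_ge mg c0.
rewrite -[X in mu X]setIT -integral_indic//.
rewrite -ge0_integralZl_EFin//; last 2 first.
- by apply/measurable_EFinP; exact: measurable_indic.
- exact: sqr_ge0.
rewrite /energy; apply: ge0_le_integral => //.
- by move=> x _; rewrite -EFinM lee_fin mulr_ge0// sqr_ge0.
- by apply: measurable_funeM; apply/measurable_EFinP; exact: measurable_indic.
- exact/measurable_EFinP.
move=> x _; rewrite -EFinM lee_fin indicE.
have [|] := boolP (x \in _); rewrite ?mulr0 ?sqr_ge0// inE mulr1 => cg.
by rewrite ler_sqr ?nnegrE ?normc_ge0// ltW.
Qed.

Let half_gt0 i : (0 : R) < 2^-1 ^+ i.
Proof. by rewrite exprn_gt0// invr_gt0. Qed.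

Lemma rigid_fast_times : rigid mu T f -> exists b : nat -> nat,
  forall i, (0 < b i)%N /\
    (energy mu ((f \o iter (b i) T) \- f)%R <= ((4^-1 ^+ i.+1) ^+ 2)%:E)%E.
Proof.
move=> [t [t_incr t_cvg]].
suff /choice[b bP] : forall i, exists n, (0 < n)%N /\
    (energy mu ((f \o iter n T) \- f)%R <= ((4^-1 ^+ i.+1) ^+ 2)%:E)%E.
  by exists b.
move=> i; have e0 : (0 : R) < 4^-1 ^+ i.+1 by rewrite exprn_gt0// invr_gt0.
have [N NP] := cvg0_eventually_lt t_cvg e0.
exists (t N.+1); split.
  rewrite (leq_ltn_trans (leq0n (t N)))// ltnNge.
  by have := t_incr N.+1 N; rewrite leEnat => ->; rewrite ltnn.
by rewrite -L2dist_le ?ltW//; apply: NP.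
Qed.

(** The points at which adding the generator b i to some sum of earlier
    generators moves the value of f along the orbit by at least 2^-(i+1). *)
Definition jump_set (b : nat -> nat) i : set (borel X) :=
  \bigcup_(m in [set` subset_sums b i]) iter m T @^-1`
    [set x | 2^-1 ^+ i.+1 <= normc (f (iter (b i) T x) - f x)].

(** Each of the 2^i sets in the union has measure at most
    16^-(i+1) / 4^-(i+1) = 4^-(i+1), and 2^i 4^-(i+1) <= 2^-(i+1). *)
Lemma jump_set_small b i :
  (energy mu ((f \o iter (b i) T) \- f)%R <= ((4^-1 ^+ i.+1) ^+ 2)%:E)%E ->
  measurable (jump_set b i) /\ (mu (jump_set b i) <= (2^-1 ^+ i.+1)%:E)%E.
Proof.
move=> Ebi; pose g := ((f \o iter (b i) T) \- f)%R.
have mg : borel_complex g.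
  by apply: borel_complexB => //; exact: borel_complex_iter.
set c : R := 2^-1 ^+ i.+1; have c0 : 0 < c by exact: half_gt0.
pose J : set (borel X) := [set x | c <= normc (g x)].
have mJ : measurable J by exact: measurable_normc_ge.
have mTJ m : measurable (iter m T @^-1` J : set (borel X)).
  by rewrite -[X in measurable X]setTI; exact: (measurable_iter m T_continuous).
split; first exact: bigcup_measurable.
have muJ : (mu J <= (c ^+ 2)%:E)%E.
  have := le_trans (energy_markov mg c0) Ebi.
  rewrite (_ : 4^-1 ^+ i.+1 = c ^+ 2 :> R); last first.
    rewrite /c -exprM mulnC exprM; congr (_ ^+ _).
    by rewrite expr2 -invfM -natrM.
  rewrite -(fineK (fin_num_measure mu _ mJ)) -EFinM !lee_fin.
  by rewrite (expr2 (c ^+ 2)) ler_pM2l// exprn_gt0.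
have : (mu (jump_set b i) <= ((size (subset_sums b i))%:R * c ^+ 2)%:E)%E.
  apply: measure_seq_bigcup_le => // m.
  by rewrite invariant_measure_iter.
move=> /le_trans; apply; rewrite lee_fin size_subset_sums expr2 mulrA.
rewrite ger_pMl// /c exprS mulrCA natrX -exprMn divff ?pnatr_eq0// expr1n mulr1.
by rewrite invf_le1// ler1n.
Qed.

(** Removing from the sum n its generators of index at least M, the largest
    first, costs less than 2^-(j+1) for the index j, and these costs add up to
    2^-M - 2^-i. The sum m of the remaining generators depends on n only: it
    serves all the points of K at once, which equicontinuity requires. *)
Lemma telescope_off_jump_sets b N M i (K : set X) : (N <= M)%N -> (M <= i)%N ->
  (forall j x, K x -> (N <= j)%N -> ~ jump_set b j x) ->
  forall n, n \in subset_sums b i -> exists2 m, m \in subset_sums b M &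
    forall x, K x ->
      normc (f (iter n T x) - f (iter m T x)) <= 2^-1 ^+ M - 2^-1 ^+ i.
Proof.
move=> NM Mi KJ; have -> : i = (M + (i - M))%N by rewrite subnKC.
elim: (i - M)%N => [|k IHk] n; rewrite ?addn0 ?addnS.
  by move=> nM; exists n => // x _; rewrite !subrr normc0.
set j := (M + k)%N in IHk *; rewrite /= mem_cat => /orP[/IHk[m mM mP]|].
  exists m => // x /mP/le_trans; apply.
  by rewrite lerB// exprS ger_pMl// invf_le1// ler1n.
move=> /mapP[n' n'j ->]; have [m mM mP] := IHk _ n'j; exists m => // x Kx.
have jump :
    normc (f (iter (b j) T (iter n' T x)) - f (iter n' T x)) < 2^-1 ^+ j.+1.
  rewrite ltNge; apply/negP => big; apply: (KJ j x Kx).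
    by rewrite (leq_trans NM)// leq_addr.
  by exists n'.
rewrite iterD; apply: (le_trans (normcB_le _ (f (iter n' T x)) _)).
have := mP x Kx; move: jump.
have : (2^-1 : R) ^+ j = 2^-1 ^+ j.+1 + 2^-1 ^+ j.+1.
  by rewrite exprS; move: (_ ^+ j) => h; lra.
move=> -> *; lra.
Qed.

Lemma uniformly_continuous_iterates (K : set X) (s : seq nat) (e : R) : 0 < e ->
  (forall m,
    uniformly_continuous_on K (fun x => complex.Re (f (iter m T x)))) ->
  (forall m,
    uniformly_continuous_on K (fun x => complex.Im (f (iter m T x)))) ->
  exists2 d : R, 0 < d & forall m x y, m \in s -> K x -> K y -> mdist x y < d ->
    normc (f (iter m T x) - f (iter m T y)) < e.
Proof.
move=> e0 KRe KIm; elim: s => [|m s [d d0 dP]]; first by exists 1.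
have e2 : 0 < e / 2 by rewrite divr_gt0.
have [r r0 rP] := KRe m _ e2; have [q q0 qP] := KIm m _ e2.
exists (Num.min d (Num.min r q)); first by rewrite !lt_min d0 r0.
move=> m' x y; rewrite inE => + Kx Ky; rewrite !lt_min => + /and3P[xyd xyr xyq].
case/orP => [/eqP ->|m's]; last exact: dP.
rewrite (le_lt_trans (normc_le_ReIm _))// (splitr e).
have := rP x y Kx Ky xyr; have := qP x y Kx Ky xyq.
by case: (f (iter m T x)) (f (iter m T y)) => [u v] [u' v'] /= *; exact: ltrD.
Qed.

(** A difference of two values at time a n exceeds the one at the truncated
    time m by at most twice the telescoping error, and only finitely many
    truncated times occur. *)
Lemma fast_times_equicontinuous (b a : nat -> nat) :
  (forall i, (energy mu ((f \o iter (b i) T) \- f)%R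
     <= ((4^-1 ^+ i.+1) ^+ 2)%:E)%E) ->
  (forall n, FS b (a n)) ->
  mu_equicontinuous_along mu T f a.
Proof.
move=> Eb ab tau tau0.
have small (e : R) : 0 < e -> exists N, forall M, (N <= M)%N -> 2^-1 ^+ M < e.
  move=> e0; have /(cvgrPdist_lt _ _)/(_ e e0)[N _ NP] :
    (2^-1 : R) ^+ n @[n --> \oo] --> 0.
    by apply: cvg_expr; rewrite ger0_norm ?invr_ge0// invf_lt1// ltr1n.
  by exists N => M NM; have := NP M NM; rewrite /= sub0r normrN gtr0_norm.
have [N /(_ N (leqnn _)) Ntau] := small (tau / 2) (divr_gt0 tau0 (ltr0n R 2)).
pose B : set (borel X) := \bigcup_k jump_set b (k + N).
have mJ k : measurable (jump_set b (k + N)).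
  by have [] := jump_set_small (Eb (k + N)%N).
have mB : measurable B by exact: bigcupT_measurable.
(* The measures of the jump sets of index >= N add up to at most 2^-N. *)
have muB : (mu B <= (tau / 2)%:E)%E.
  apply: le_trans; first exact: (measure_sigma_subadditive mu mJ mB).
  apply: (@le_trans _ _ (2^-1 ^+ N)%:E); last by rewrite lee_fin ltW.
  apply: le_trans (epsilon_trick0 xpredT (ltW (half_gt0 N))).
  apply: lee_nneseries => // k _; have [_] := jump_set_small (Eb (k + N)%N).
  by rewrite -addSn exprD natrX -exprVn (mulrC (2^-1 ^+ k.+1)).
pose g (j : nat * bool) x : R := if j.2 then complex.Re (f (iter j.1 T x))
  else complex.Im (f (iter j.1 T x)).
have mg j : measurable_fun [set: borel X] (g j).
  have [] := borel_complex_iter j.1 T_continuous f_borel.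
  by rewrite /g; case: j.2.
have [K [cK KB muK uK]] := regular_lusin mu_regular mg (measurableC mB)
  (divr_gt0 tau0 (ltr0n R 2)).
exists K; split => //; last first.
  have mK := compact_borel cK; rewrite probability_setC// in muK.
  move: muK muB; rewrite -(fineK (fin_num_measure mu _ mK)).
  rewrite -(fineK (fin_num_measure mu _ mB)) -EFinB -EFinD !lte_fin !lee_fin.
  move: (fine _) (fine _) => *; lra.
have KJ j x : K x -> (N <= j)%N -> ~ jump_set b j x.
  by move=> /KB nB Nj Jx; apply: nB; exists (j - N)%N => //; rewrite subnK.
move=> e e0; have [M0 M0P] := small (e / 4) (divr_gt0 e0 (ltr0n R 4)).
pose M := maxn M0 N; have Me := M0P M (leq_maxl _ _).
have [d d0 dP] := uniformly_continuous_iterates (subset_sums b M)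
  (divr_gt0 e0 (ltr0n R 2)) (fun m => uK (m, true)) (fun m => uK (m, false)).
exists d; split => // x y Kx Ky xy n.
have [i ni] := FS_subset_sums (ab n).
have [m mM mP] := @telescope_off_jump_sets b N M (maxn M i) K (leq_maxr _ _)
  (leq_maxl _ _) KJ _ (subset_sums_mono (leq_maxr _ _) ni).
have := dP m x y mM Kx Ky xy; have := mP x Kx; have := mP y Ky.
rewrite (normcB (f (iter _ T y))); have := half_gt0 (maxn M i).
have := normcB_le (f (iter (a n) T x)) (f (iter m T x)) (f (iter (a n) T y)).
have := normcB_le (f (iter m T x)) (f (iter m T y)) (f (iter (a n) T y)).
lra.
Qed.

End RigidEquicontinuous.

(** * Equicontinuity along a sequence implies rigidity *)

(** Pigeonhole principle on the multiples of k + 1. *)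
Lemma finite_coloring_repeats (I : finType) (c : nat -> I) (k : nat) :
  exists i j, [/\ (i < j)%N, (i + k <= j)%N & c i = c j].
Proof.
pose c' (m : 'I_#|I|.+1) := c (m * k.+1)%N.
have /injectivePn[u [v uv cuv]] : ~~ injectiveb c'.
  apply/negP => /injectiveP/leq_card; rewrite card_ord ltnn //.
wlog uv' : u v uv cuv / (u < v)%N.
  move=> th; have [] := ltngtP u v; first exact: th.
    by move=> vu; apply: (th v u) => //; rewrite eq_sym.
  by move=> /val_inj/eqP; rewrite (negbTE uv).
have le : (u * k.+1 + k.+1 <= v * k.+1)%N by rewrite -mulSnr leq_mul2r uv' orbT.
by exists (u * k.+1)%N, (v * k.+1)%N; split => //; lia.
Qed.

Section Quantization.
Context {R : realType}.

Lemma truncn_eq_dist (d r s : R) : 0 < d -> 0 <= r -> 0 <= s ->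
  Num.truncn (r / d) = Num.truncn (s / d) -> `|r - s| < d.
Proof.
move=> d0 r0 s0 rs.
have [rd sd] : 0 <= r / d /\ 0 <= s / d by rewrite !divr_ge0// ltW.
have /andP[r1 r2] := truncn_itv rd; have /andP[s1 s2] := truncn_itv sd.
rewrite -rs in s1 s2; move: r1 r2 s1 s2; rewrite !ler_pdivlMr// !ltr_pdivrMr//.
by rewrite -natr1 ltr_norml; move: (_%:R) => n *; apply/andP; split; nra.
Qed.

(** Round both coordinates to a grid of mesh d / 2, with one extra symbol for
    all the numbers of modulus larger than M. *)
Lemma bounded_complex_quantizer (M d : R) : 0 < d ->
  exists (Q : finType) (q : R[i] -> Q), forall z w : R[i], q z = q w ->
    normc (z - w) < d \/ (M < normc z /\ M < normc w).
Proof.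
move=> d0; pose e := d / 2; have e0 : 0 < e by rewrite divr_gt0.
pose lvl r := Num.truncn ((r + M) / e); pose L := Num.truncn ((M + M) / e).
exists (option ('I_L.+1 * 'I_L.+1)%type).
exists (fun z => if normc z <= M then
  Some (inord (lvl (complex.Re z)), inord (lvl (complex.Im z))) else None).
have inj r s : `|r| <= M -> `|s| <= M ->
    inord (lvl r) = inord (lvl s) :> 'I_L.+1 -> `|r - s| < e.
  move=> /ler_normlP[r1 r2] /ler_normlP[s1 s2] /(congr1 val) /=.
  have lvlL t : t <= M -> (lvl t < L.+1)%N.
    move=> tM; rewrite ltnS; apply: le_truncn.
    by rewrite ler_pM2r ?invr_gt0// lerD2r.
  rewrite !inordK ?lvlL// => rs.
  rewrite (_ : r - s = (r + M) - (s + M)); last by ring.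
  by apply: truncn_eq_dist => //; lra.
move=> z w; case: (leP (normc z) M) => zM; case: (leP (normc w) M) => wM //;
  last by move=> _; right; split.
move=> [/inj re /inj im]; left.
rewrite (le_lt_trans (normc_le_ReIm _))// (splitr d) ltrD//.
- have := re (le_trans (Re_le_normc z) zM) (le_trans (Re_le_normc w) wM).
  by case: (z) (w) => [a b] [a' b'].
- have := im (le_trans (Im_le_normc z) zM) (le_trans (Im_le_normc w) wM).
  by case: (z) (w) => [a b] [a' b'].
Qed.

End Quantization.

Lemma compact_finite_net (R : realType) (X : pointedMetricType R)
    (K : set X) (d : R) :
  compact K -> 0 < d -> exists D : {fset X}, [set` D] `<=` K /\
    forall x, K x -> exists2 y, y \in D & mdist y x < d.
Proof.
move=> + d0; rewrite compact_cover => cK.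
have [|x Kx|D DK KD] := cK X K (fun x => (ball x d)^°).
- by move=> x _; exact: open_interior.
- by exists x => //; apply: nbhsx_ballx.
exists D; split; first by move=> x /DK; rewrite inE.
move=> x /KD[y /= yD /interior_subset yx]; exists y => //.
by move: yx; rewrite ballEmdist.
Qed.

Section EquicontinuousRecurrence.
Context (R : realType) (X : pointedMetricType R) (mu : probability (borel X) R).
Variables (T : X -> X) (f : X -> R[i]).
Hypothesis T_continuous : continuous T.
Hypothesis mu_invariant : invariant_measure mu T.
Hypothesis f_L2 : L2 mu f.

Let f_borel : borel_complex f. Proof. by case: f_L2. Qed.

(** Stated with squares because the squared modulus is a polynomial in the real
    and imaginary parts, hence clearly measurable. *)
Definition sqr_tail (M : R) x : R :=
  if M ^+ 2 < normc (f x) ^+ 2 then normc (f x) ^+ 2 else 0.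

Lemma sqr_tail_ge0 M x : 0 <= sqr_tail M x.
Proof. by rewrite /sqr_tail; case: ifP => // _; exact: sqr_ge0. Qed.

Lemma sqr_normc_le_tail M x : normc (f x) ^+ 2 <= M ^+ 2 + sqr_tail M x.
Proof.
by rewrite /sqr_tail; case: ltP => [_|]; rewrite ?addr0// lerDr sqr_ge0.
Qed.

Lemma sqr_tailE M x : 0 <= M -> M < normc (f x) ->
  sqr_tail M x = normc (f x) ^+ 2.
Proof.
by move=> M0 Mf; rewrite /sqr_tail ltr_sqr ?nnegrE ?normc_ge0// Mf.
Qed.

Lemma measurable_sqr_tail M : measurable_fun [set: borel X] (sqr_tail M).
Proof.
have mf := measurable_sqr_normc f_borel.
by apply: measurable_fun_ifT => //; apply: measurable_fun_ltr.
Qed.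

(** Dominated convergence: the tail at M = n vanishes at x for large n. *)
Lemma integral_sqr_tail_small (e : R) : 0 < e ->
  exists M : R, 0 < M /\ (\int[mu]_x (sqr_tail M x)%:E <= e%:E)%E.
Proof.
move=> e0; have mf := measurable_sqr_normc f_borel.
have [_ _] : [/\ mu.-integrable setT (cst 0%E : borel X -> \bar R),
  (\int[mu]_x `| (sqr_tail n%:R x)%:E - cst 0%E x |)%E @[n --> \oo] --> 0%E &
  (\int[mu]_x (sqr_tail n%:R x)%:E)%E @[n --> \oo] -->
    (\int[mu]_x (cst 0%E x : \bar R))%E].
  apply: (@dominated_convergence _ _ _ mu setT measurableT
    (fun n x => (sqr_tail n%:R x)%:E) (cst 0%E)
    (fun x => (normc (f x) ^+ 2)%:E)) => //.
  - by move=> n; apply/measurable_EFinP; exact: measurable_sqr_tail.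
  - apply: nearW => x _; apply: cvg_near_cst; near=> n.
    rewrite /sqr_tail ltNge ler_sqr ?nnegrE ?normc_ge0//.
    rewrite (_ : normc (f x) <= n%:R = true)//.
    by near: n; exact: nbhs_infty_ger.
  - apply/integrableP; split; first exact/measurable_EFinP.
    under eq_integral do rewrite gee0_abs ?lee_fin ?sqr_ge0//.
    exact: (L2_energy f_L2).
  - apply: nearW => x n _; rewrite gee0_abs ?lee_fin ?sqr_tail_ge0//.
    by rewrite /sqr_tail; case: ifP => // _; exact: sqr_ge0.
rewrite integral_cst// mul0e => tail0.
have [N NP] := cvg0_eventually_lt tail0 e0.
by exists N.+1%:R; split => //; apply/ltW/NP.
Unshelve. all: by end_near. Qed.

(** The indices i and j enter the bound only through tails, whose integrals are
    those of the tail of f by invariance: this plays the role of the uniform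
    integrability of the squares of the iterates. *)
Lemma integral_truncation_bound (K : set X) (c M e t : R) (i j : nat) :
  compact K -> 0 <= c -> (mu (~` K) <= t%:E)%E ->
  (\int[mu]_x (sqr_tail M x)%:E <= e%:E)%E ->
  (forall x, normc (f (iter i T x) - f (iter j T x)) ^+ 2 <=
     c * \1_K x + 4 * M ^+ 2 * \1_(~` K) x +
     (2 * sqr_tail M (iter i T x) + 2 * sqr_tail M (iter j T x))) ->
  (energy mu ((f \o iter i T) \- (f \o iter j T))%R <=
     (c + 4 * M ^+ 2 * t + 4 * e)%:E)%E.
Proof.
move=> cK c0 muK tailM le_pw.
have mK : measurable (K : set (borel X)) := compact_borel cK.
have M2_ge0 : 0 <= 4 * M ^+ 2 by rewrite mulr_ge0// sqr_ge0.
have mtail := measurable_sqr_tail M.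
have mtailT n :
    measurable_fun [set: borel X] (fun x => sqr_tail M (iter n T x)).
  exact: (measurableT_comp mtail (measurable_iter n T_continuous)).
pose A (x : borel X) := (c * \1_K x)%:E.
pose B (x : borel X) := (4 * M ^+ 2 * \1_(~` K) x)%:E.
pose C n (x : borel X) := (2 * sqr_tail M (iter n T x))%:E.
have mA : measurable_fun setT A.
  by apply/measurable_EFinP; exact: measurable_funM.
have mB : measurable_fun setT B.
  apply/measurable_EFinP; apply: measurable_funM => //; apply: measurable_indic.
  exact: measurableC.
have mC n : measurable_fun setT (C n).
  by apply/measurable_EFinP; apply: measurable_funM.
have A0 x : (0 <= A x)%E by rewrite lee_fin mulr_ge0.
have B0 x : (0 <= B x)%E by rewrite lee_fin mulr_ge0.
have C0 n x : (0 <= C n x)%E by rewrite lee_fin mulr_ge0// sqr_tail_ge0.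
have intA : (\int[mu]_x A x <= c%:E)%E.
  rewrite /A; under eq_integral do rewrite EFinM.
  rewrite ge0_integralZl_EFin//; last first.
    by apply/measurable_EFinP; exact: measurable_indic.
  rewrite integral_indic// setIT -[leRHS]mule1 lee_pmul// ?lee_fin//.
  exact: probability_le1.
have intB : (\int[mu]_x B x <= (4 * M ^+ 2 * t)%:E)%E.
  rewrite /B; under eq_integral do rewrite EFinM.
  rewrite ge0_integralZl_EFin//; last first.
    by apply/measurable_EFinP; apply: measurable_indic; exact: measurableC.
  rewrite integral_indic//; last exact: measurableC.
  by rewrite setIT [leRHS]EFinM lee_pmul.
have intC n : (\int[mu]_x C n x <= (2 * e)%:E)%E.
  rewrite /C; under eq_integral do rewrite EFinM.
  rewrite ge0_integralZl_EFin//; last 2 first.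
  - by move=> x _; rewrite lee_fin sqr_tail_ge0.
  - exact/measurable_EFinP.
  rewrite invariant_integral//; last by move=> x; exact: sqr_tail_ge0.
  rewrite EFinM lee_pmul// integral_ge0// => x _.
  by rewrite lee_fin sqr_tail_ge0.
apply: (@le_trans _ _ (\int[mu]_x ((A x + B x) + (C i x + C j x)))%E).
  apply: ge0_le_integral => //.
  - by move=> x _; rewrite lee_fin sqr_ge0.
  - apply/measurable_EFinP; apply: measurable_sqr_normc.
    by apply: borel_complexB; exact: borel_complex_iter.
  - by apply: emeasurable_funD; exact: emeasurable_funD.
  - by move=> x _; rewrite -!EFinD lee_fin; exact: le_pw.
rewrite ge0_integralD//; last 4 first.
- by move=> x _; rewrite adde_ge0.
- exact: emeasurable_funD.
- by move=> x _; rewrite adde_ge0.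
- exact: emeasurable_funD.
rewrite !ge0_integralD//.
rewrite (_ : 4 * e = 2 * e + 2 * e); last by ring.
by rewrite !EFinD; apply: leeD; apply: leeD.
Qed.

Lemma energy_iterB i j : (i <= j)%N ->
  energy mu ((f \o iter j T) \- (f \o iter i T))%R =
  energy mu ((f \o iter (j - i) T) \- f)%R.
Proof.
move=> ij; rewrite /energy.
rewrite -[RHS](@invariant_integral _ _ _ T i
  (fun x => normc (f (iter (j - i) T x) - f x) ^+ 2))//.
- by apply: eq_integral => x _ /=; rewrite -iterD subnK.
- apply: (@measurable_sqr_normc _ _ ((f \o iter (j - i) T) \- f)%R).
  by apply: borel_complexB => //; exact: borel_complex_iter.
- by move=> x; exact: sqr_ge0.
Qed.

(** The pigeonhole principle is applied to the rounded values of
    f o T^(a n) at the points of a finite net of K. *)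
Lemma equicontinuous_almost_return (a : nat -> nat) (e : R) (k : nat) :
  increasing_seq a -> mu_equicontinuous_along mu T f a -> 0 < e ->
  exists2 n, (k <= n)%N & (energy mu ((f \o iter n T) \- f)%R <= e%:E)%E.
Proof.
move=> incr_a eqc e0.
have [M [M0 tailM]] := integral_sqr_tail_small (divr_gt0 e0 (ltr0n R 16)).
(* The bounds below use one quarter of e for each of three errors: closeness on
   K, the complement of K, and the tails. *)
pose t := e / (16 * M ^+ 2).
have t0 : 0 < t by rewrite divr_gt0// mulr_gt0// exprn_gt0.
have [K [cK eqcK muK]] := eqc t t0.
have muKC : (mu (~` K) <= t%:E)%E.
  have mK := compact_borel cK; rewrite probability_setC//.
  move: muK; rewrite -(fineK (fin_num_measure mu _ mK)) -EFinB !lee_fin lte_fin.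
  by move: (fine _) => *; lra.
pose eta := Num.sqrt (e / 4) / 3.
have eta0 : 0 < eta by rewrite divr_gt0// sqrtr_gt0 divr_gt0.
have etaE : (3 * eta) ^+ 2 = e / 4.
  by rewrite mulrC divfK ?pnatr_eq0// sqr_sqrtr// divr_ge0// ltW.
have [d [d0 dK]] := eqcK eta eta0.
have [D [DK KD]] := compact_finite_net cK d0.
(* The margin eta ensures that a value larger than M + eta at a point of the net
   forces values larger than M at all the nearby points of K. *)
have [Q [q qP]] := @bounded_complex_quantizer R (M + eta) eta eta0.
pose c n := [ffun y : D => q (f (iter (a n) T (val y)))].
have [i [j [ij ikj cij]]] := finite_coloring_repeats c k.
have a_gap m : (a i + m <= a (i + m))%N.
  elim: m => [|m IHm]; first by rewrite !addn0.
  rewrite !addnS (leq_ltn_trans IHm)// ltnNge.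
  by have := incr_a (i + m).+1 (i + m); rewrite leEnat => ->; rewrite ltnn.
have aij : (a i + k <= a j)%N.
  rewrite (leq_trans (a_gap k))//.
  by have := incr_a (i + k)%N j; rewrite leEnat => ->.
exists (a j - a i)%N; first by rewrite leq_subRL ?(leq_trans _ aij) ?leq_addr.
rewrite -energy_iterB; last by rewrite (leq_trans _ aij) ?leq_addr.
have -> : e = e / 4 + 4 * M ^+ 2 * t + 4 * (e / 16) + e / 4.
  by rewrite /t; field; rewrite gt_eqF.
apply: (@le_trans _ _ (e / 4 + 4 * M ^+ 2 * t + 4 * (e / 16))%:E); last first.
  by rewrite lee_fin lerDl divr_ge0// ltW.
apply: (integral_truncation_bound cK _ muKC tailM).
  by rewrite divr_ge0// ltW.
move=> x; set u := f _; set v := f _.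
have tu := sqr_tail_ge0 M (iter (a j) T x).
have tv := sqr_tail_ge0 M (iter (a i) T x).
have uv2 := sqr_normcB_le u v.
have [Kx|nKx] := pselect (K x).
- rewrite !indicE (mem_set Kx) (memNset (A := ~` K)); last by move=> /(_ Kx).
  rewrite mulr1 mulr0 addr0.
  have [y yD yx] := KD x Kx; have Ky := DK _ yD.
  have yu := dK y x Ky Kx yx j; have yv := dK y x Ky Kx yx i.
  rewrite -/u in yu; rewrite -/v in yv.
  move/ffunP/(_ [` yD]%fset): cij; rewrite !ffunE /= => /qP[].
    set u' := f (iter (a j) T y) in yu *; set v' := f (iter (a i) T y) in yv *.
    move=> vu'; have : normc (u - v) < 3 * eta.
      have := normcB_le u u' v; have := normcB_le u' v' v.
      by rewrite (normcB u u') (normcB u' v'); lra.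
    move=> /ltW uv; have : normc (u - v) ^+ 2 <= (3 * eta) ^+ 2.
      by rewrite ler_sqr ?nnegrE ?normc_ge0// mulr_ge0// ltW.
    by rewrite etaE; lra.
  (* Both values are large at y, hence at x: the tails dominate. *)
  move=> [Mv Mu].
  have far z w : M + eta < normc z -> normc (z - w) < eta -> M < normc w.
    move=> Mz zw; have := le_normcD (z - w) w; rewrite subrK; lra.
  rewrite !sqr_tailE ?(ltW M0)//; [|exact: far Mv yv|exact: far Mu yu].
  by rewrite -/u -/v; lra.
- rewrite !indicE (memNset nKx) (mem_set (A := ~` K))// mulr0 mulr1 add0r.
  have := sqr_normc_le_tail M (iter (a j) T x).
  have := sqr_normc_le_tail M (iter (a i) T x).
  by rewrite -/u -/v; lra.
Qed.

(** Choose the times one after the other, each later than the previous one and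
    with L2 error at most 1 / (k + 1). *)
Lemma rigid_of_almost_returns :
  (forall (e : R) k, 0 < e ->
    exists2 n, (k <= n)%N & (energy mu ((f \o iter n T) \- f)%R <= e%:E)%E) ->
  rigid mu T f.
Proof.
move=> ret.
have /choice[s sP] : forall p : nat * nat, exists n, (p.2 <= n)%N /\
    (L2dist mu (fun x => f (iter n T x)) f <= (p.1.+1%:R^-1)%:E)%E.
  move=> [m N]; have [|n Nn En] := ret ((m.+1%:R^-1) ^+ 2) N.
    by rewrite exprn_gt0// invr_gt0.
  by exists n; split => //; rewrite L2dist_le.
pose t := fix t k := if k is m.+1 then s (k, (t m).+1) else s (0%N, 0%N).
exists t; split.
  apply/increasing_seqP => n; rewrite ltEnat /=.
  by have [] := sP (n.+1, (t n).+1).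
have tP k : (L2dist mu (fun x => f (iter (t k) T x)) f <= (k.+1%:R^-1)%:E)%E.
  by case: k => [|k]; [have [] := sP (0%N, 0%N)|have [] := sP (k.+1, (t k).+1)].
apply: (@squeeze_cvge _ _ _ _ (cst 0%E) _ (fun k => (k.+1%:R^-1 : R)%:E)).
- by apply: nearW => k; rewrite L2dist_ge0 tP.
- exact: cvg_cst.
- by apply: cvg_EFin; [exact: nearW|exact: cvg_harmonic].
Qed.

End EquicontinuousRecurrence.

Theorem theorem3p14 (R : realType) (X : pointedMetricType R) (T : X -> X)
    (mu : probability (borel X) R) (f : X -> R[i])
    (X_compact : compact [set: X])
    (T_homeo : homeomorphism T)
    (mu_regular : regular_measure mu)
    (mu_invariant : invariant_measure mu T)
    (f_L2 : L2 mu f) :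
  rigid mu T f <->
  exists F : set nat, IP_set F /\
    exists a : nat -> nat,
      increasing_listing F a /\ mu_equicontinuous_along mu T f a.
Proof.
have [T_continuous _] := T_homeo.
have f_borel : borel_complex f by case: f_L2.
split=> [/rigid_fast_times[b /all_and2[b_gt0 Eb]]|].
  exists (FS b); split; first by exists b.
  have [a a_lists] :=
    unbounded_increasing_listing (fun n => FS_unbounded n b_gt0).
  exists a; split => //; apply: fast_times_equicontinuous => // n.
  by have [_ <-] := a_lists; exists n.
move=> [F [_ [a [[a_incr _] a_eqc]]]].
apply: rigid_of_almost_returns => e k e_gt0.
exact: (equicontinuous_almost_return T_continuous mu_invariant f_L2 _ a_incr
  a_eqc).
Qed.
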